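(* Let $T>0$, let $e:\mathbb{R}\to\mathbb{R}$ be locally Lipschitz with $e(r)=0$ if and only if $r=0$ and $\lim_{r\to\pm\infty}e(r)=\pm\infty$, and let $f:(0,T)\to\mathbb{R}$ be Lipschitz continuous (extended continuously to $t=0$) with $|f(0)|\le1$. Assume that $f$ is strictly increasing with $f'\ge\gamma$ (almost everywhere) for some $\gamma>0$. For $\epsilon>0$ let $u_\epsilon$ be the unique viscosity solution of $$\epsilon u_t+\partial R(u_t)+e(u)\ni f\ \text{ in }(0,T),\qquad u(0)=0,$$ and put $u_{\rm vis}(t):=\sup_{\epsilon>0}u_\epsilon(t)$. Let $V$ be the smaller Perron solution of $$\partial R(u_t)+e(u)\ni f\ \text{ in }(0,T),\qquad u(0)=0.$$ Then $u_{\rm vis}=V_*$ on $(0,T)$.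
   Context: $\partial R(a)=[-1,1]$ if $a=0$ and $\partial R(a)=\{\operatorname{sgn}(a)\}$ if $a\neq0$. ''Increasing'' without ''strictly'' means nondecreasing. $w^*$ and $w_*$ are the upper- and lower-semicontinuous envelopes of $w$. Jets: for upper-semicontinuous $w$ on $(0,T)$, $\mathcal{P}^{1,+}w(t)=\{a\in\mathbb{R}: w(s)\le w(t)+a(s-t)+o(|s-t|)\text{ as }s\to t\}$, and for lower-semicontinuous $w$, $\mathcal{P}^{1,-}w=-\mathcal{P}^{1,+}(-w)$. Viscosity solutions: for $\epsilon\ge0$, continuous $g:\mathbb{R}\to\mathbb{R}$ and continuous $f$, an upper-semicontinuous $w:(0,T)\to\mathbb{R}$ is a viscosity subsolution of $\epsilon u_t+\partial R(u_t)+g(u)\ni f$ if for every $t\in(0,T)$ and $a\in\mathcal{P}^{1,+}w(t)$ there is $\mu\in\partial R(a)$ with $\epsilon a+\mu+g(w(t))\le f(t)$; a lower-semicontinuous $w$ is a viscosity supersolution if for every $t$ and $b\in\mathcal{P}^{1,-}w(t)$ there is $\nu\in\partial R(b)$ with $\epsilon b+\nu+g(w(t))\ge f(t)$. A continuous function which is both is a viscosity solution. (For each $\epsilon>0$ the problem for $u_\epsilon$ has a unique viscosity solution that is continuous on $[0,T)$ with $u_\epsilon(0)=0$.) Perron solution $V$: let $e_m(x)=\sup\{m(x): m\text{ increasing},\ m\le e\}$. Fix a differentiable decreasing function $\underline u:[0,T)\to\mathbb{R}$ with $\underline u(0)=0$ (a viscosity subsolution), and a continuous function $\overline v:[0,T)\to\mathbb{R}$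 with $\overline v(0)=0$ that is the viscosity solution of $\partial R(v_t)+m(v)\ni f$ in $(0,T)$ for some continuous strictly increasing $m\le e_m$ (a viscosity supersolution of $\partial R(u_t)+e(u)\ni f$), so that $\underline u\le\overline v$. Then $$V(t)=\inf\{\tilde v(t): \tilde v\text{ is a viscosity supersolution of }\partial R(u_t)+e(u)\ni f\text{ with }\underline u\le\tilde v\le\overline v\text{ on }(0,T)\}.$$ *)

(* Defs.v *)
From mathcomp Require Import all_boot all_order all_algebra.
From mathcomp Require Import all_classical all_reals all_analysis.
Set Implicit Arguments.
Unset Strict Implicit.
Unset Printing Implicit Defensive.
Import Order.TTheory GRing.Theory Num.Theory.
Import numFieldNormedType.Exports.
Local Open Scope classical_set_scope.
Local Open Scope ring_scope.

(* Functions on (0, T) or [0, T) are total functions R -> R of which only the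
   values on that interval are used: since (0, T) is open, semicontinuity and
   jets at one of its points only depend on the values inside (0, T). *)

Definition subdiffR (R : realType) (a : R) : set R :=
  if a == 0 then `[-1, 1]%classic else [set Num.sg a].

Definition usc_on (R : realType) (T : R) (w : R -> R) : Prop :=
  forall t : R, t \in `]0, T[ -> forall c, w t < c -> \forall s \near t, w s < c.

Definition lsc_on (R : realType) (T : R) (w : R -> R) : Prop :=
  forall t : R, t \in `]0, T[ -> forall c, c < w t -> \forall s \near t, c < w s.

Definition superjet (R : realType) (w : R -> R) (t : R) : set R :=
  [set a | exists2 r : R -> R, r =o_t (fun s => `|s - t|) &
     \forall s \near t, w s <= w t + a * (s - t) + r s].

Definition subjet (R : realType) (w : R -> R) (t : R) : set R :=
  [set - a | a in superjet (\- w) t].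

(* The inclusion is [eps * u_t + subdiffR u_t + g u \ni f] in (0, T); the case
   [eps = 0] is the rate-independent one. *)

Definition visc_subsol (R : realType) (T eps : R) (g f w : R -> R) : Prop :=
  usc_on T w /\
  forall t : R, t \in `]0, T[ -> forall a, superjet w t a ->
    exists2 mu, subdiffR a mu & eps * a + mu + g (w t) <= f t.

Definition visc_supersol (R : realType) (T eps : R) (g f w : R -> R) : Prop :=
  lsc_on T w /\
  forall t : R, t \in `]0, T[ -> forall b, subjet w t b ->
    exists2 nu, subdiffR b nu & f t <= eps * b + nu + g (w t).

Definition visc_sol (R : realType) (T eps : R) (g f w : R -> R) : Prop :=
  [/\ {within `]0, T[, continuous w},
      visc_subsol T eps g f w & visc_supersol T eps g f w].

Definition visc_ivp_sol (R : realType) (T eps : R) (g f w : R -> R) : Prop :=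
  [/\ {within `[0, T[, continuous w}, w 0 = 0 & visc_sol T eps g f w].

Definition locally_lipschitz (R : realType) (g : R -> R) : Prop :=
  forall x : R, exists2 U : set R, nbhs x U & [lipschitz g y | y in U].

(* At [0] the derivative is the right derivative. *)
Definition differentiable_co (R : realType) (T : R) (w : R -> R) : Prop :=
  (forall t : R, t \in `]0, T[ -> derivable w t 1) /\
  cvg ((w s - w 0) / s @[s --> 0^'+]).

(* If [e] tends to [-oo] at [-oo] and to [+oo] at [+oo], the set below is
   nonempty and bounded, so [sup] is a genuine supremum. *)
Definition monotone_minorant (R : realType) (e : R -> R) (x : R) : R :=
  sup [set m x | m in [set m : R -> R |
                        nondecreasing_fun m /\ forall y, m y <= e y]].

Definition perron (R : realType) (T : R) (e f lo hi : R -> R) (t : R) : \bar R :=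
  ereal_inf [set (v t)%:E | v in [set v : R -> R |
    visc_supersol T 0 e f v /\
    forall s : R, s \in `]0, T[ -> lo s <= v s <= hi s]].

(* [nbhs t] is not punctured, so the value [w t] is taken into account. *)
Definition lsc_env (R : realType) (T : R) (w : R -> \bar R) (t : R) : \bar R :=
  limf_einf w (within `]0, T[ (nbhs t)).

Definition u_vis (R : realType) (u : R -> R -> R) (t : R) : \bar R :=
  ereal_sup [set (u eps t)%:E | eps in [set eps | 0 < eps]].

(* Main.v *)
(* Let [U t] be the least [x >= 0] with [f t - 1 <= e x]; both sides equal [U t].
   A supersolution has no subjet of small slope at a time near [t] where its
   value lies in [0, x], if [e < f t - 1] on [0, x]; since a lower semicontinuous
   function can be touched from below by steep parabolas, this forces [v t >= x],
   for [eps = 0] and for every small enough [eps > 0]. Hence [U] lies below every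
   Perron competitor and below [u_vis]. Conversely [U] is itself a
   lower semicontinuous competitor, and the level [U t], at which
   [e (U t) >= f s - 1] for all [s <= t], cannot be crossed before [t] by the
   viscous solutions because [e] is locally Lipschitz. *)

Require Import Defs.
From mathcomp Require Import all_boot all_order all_algebra.
From mathcomp Require Import all_classical all_reals all_analysis.
From mathcomp Require Import ring lra.
Import Order.TTheory GRing.Theory Num.Theory.
Import numFieldNormedType.Exports.
Local Open Scope classical_set_scope.
Local Open Scope ring_scope.

Set Implicit Arguments.
Unset Strict Implicit.
Unset Printing Implicit Defensive.

(** * Jets, test functions and minima of semicontinuous functions *)

Lemma superjetP (R : realType) (w : R -> R) (t a : R) :
  superjet w t a <-> forall eps, 0 < eps ->
    \forall s \near t, w s <= w t + a * (s - t) + eps * `|s - t|.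
Proof.
split=> [[r /eqoP ro wr] eps eps0|wa].
  near=> s; apply: (@le_trans _ _ (w t + a * (s - t) + r s)).
    by near: s.
  rewrite lerD2l (le_trans (ler_norm _))// -[X in eps * X]normr_id.
  by near: s; exact: ro.
(* The remainder is the positive part of the excess of [w] over the affine function of slope [a]. *)
exists (fun s => Num.max 0 (w s - w t - a * (s - t))).
  apply/eqoP => eps eps0; near=> s.
  have es : 0 <= eps * `|s - t| by rewrite mulr_ge0 // ltW.
  rewrite ger0_norm ?le_max ?lexx// normr_id ge_max es /= !lerBlDl addrA.
  by near: s; exact: wa.
by near=> s; rewrite -lerBlDl opprD addrA le_max lexx orbT.
Unshelve. all: by end_near. Qed.

Lemma is_derive_le_near (R : realType) (phi : R -> R) (t a eps : R) :
  is_derive t 1 phi a -> 0 < eps ->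
  \forall s \near t, phi s <= phi t + a * (s - t) + eps * `|s - t|.
Proof.
move=> [dphi <-] eps0.
have /eqaddoP/(_ _ eps0) := derivable_nbhs dphi.
rewrite (near_shift 0) => near_t; near=> h => /=.
have : `|phi (h *: 1 + t) - (phi t + h *: 'D_1 phi t)| <= eps * `|h|.
  by near: h; exact: near_t.
rewrite subr0 addrK scaler1 [_ * h]mulrC => /(le_trans (ler_norm _)).
by rewrite lerBlDl.
Unshelve. all: by end_near. Qed.

Lemma superjet_le_is_derive (R : realType) (w phi : R -> R) (t a : R) :
  is_derive t 1 phi a -> w t = phi t -> (\forall s \near t, w s <= phi s) ->
  superjet w t a.
Proof.
move=> dphi wt wphi; apply/superjetP => eps eps0; near=> s.
rewrite wt; apply: (@le_trans _ _ (phi s)); near: s => //.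
exact: is_derive_le_near.
Unshelve. all: by end_near. Qed.

Lemma subjet_ge_is_derive (R : realType) (v phi : R -> R) (t b : R) :
  is_derive t 1 phi b -> v t = phi t -> (\forall s \near t, phi s <= v s) ->
  subjet v t b.
Proof.
move=> dphi vt vphi; exists (- b); last by rewrite opprK.
apply: (@superjet_le_is_derive _ _ (- phi)); first by rewrite /= vt.
by near=> s; rewrite lerN2; near: s.
Unshelve. all: by end_near. Qed.

(** The sublevel sets [B c] are nested, hence a filter base. Compactness gives a cluster point [p],
    and a value below [h p] is impossible: near [p] all points would leave its sublevel set. *)
Lemma compact_lsc_min (R : realType) (h : R -> R) (a b : R) : a <= b ->
  (forall p, p \in `[a, b] -> forall c, c < h p ->
     \forall s \near p, s \in `[a, b] -> c < h s) ->
  exists2 p, p \in `[a, b] & forall s, s \in `[a, b] -> h p <= h s.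
Proof.
move=> ab h_lsc.
pose I : set R := `[a, b]%classic.
pose B c : set R := [set s | s \in `[a, b] /\ h s <= h c].
have aI : I a by rewrite /I /= in_itv/= lexx.
have FF : ProperFilter (filter_from I B).
  apply: filter_from_proper; last by move=> c Ic; exists c; split.
  apply: filter_from_filter; first by exists a.
  move=> c d Ic Id; have [hcd|hdc] := leP (h c) (h d).
    by exists c => // s [sI sc]; split; split=> //; exact: le_trans hcd.
  by exists d => // s [sI sd]; split; split=> //; exact: le_trans (ltW hdc).
have [|p [pI clp]] := @segment_compact R a b _ FF.
  by exists a => // s [].
exists p => // s sI; rewrite leNgt; apply/negP => hsp.
have [q [[qI hqs] /(_ qI)]] := clp _ _ (ex_intro2 _ _ s sI (fun _ => id)) (h_lsc p pI _ hsp).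
by rewrite ltNge hqs.
Qed.

(** * Lower bounds for supersolutions *)

Lemma subdiffR_le1 (R : realType) (b nu : R) : subdiffR b nu -> nu <= 1.
Proof.
rewrite /subdiffR; case: ifP => [_ /=|b0 ->]; first by rewrite in_itv/= => /andP[].
by case: sgrP => // _; rewrite ler01.
Qed.

Lemma subdiffR_lt0 (R : realType) (b nu : R) : b < 0 -> subdiffR b nu -> nu = -1.
Proof. by move=> b0; rewrite /subdiffR lt_eqF// ltr0_sg. Qed.

Lemma subdiffR_gt0 (R : realType) (b nu : R) : 0 < b -> subdiffR b nu -> nu = 1.
Proof. by move=> b0; rewrite /subdiffR gt_eqF// gtr0_sg. Qed.

Lemma subdiffR1 (R : realType) (b : R) : 0 <= b -> subdiffR b 1.
Proof.
rewrite le_eqVlt => /predU1P[<-|b0]; rewrite /subdiffR ?eqxx ?gt_eqF ?gtr0_sg//.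
by rewrite /= in_itv/= lexx andbT; lra.
Qed.

(* The minimum of [v s * (t1 - s)] over a compact interval is attained at an
   interior point when [v] is negative somewhere; there [v] is touched from
   below by a decreasing hyperbola. *)
Lemma visc_supersol_ge0 (R : realType) (T eps : R) (g f v : R -> R) :
  0 <= eps -> (forall y, y < 0 -> g y <= 0) ->
  (forall t, t \in `]0, T[ -> -1 < f t) ->
  (forall k, 0 < k -> \forall s \near 0^'+, - k < v s) ->
  visc_supersol T eps g f v -> forall t, t \in `]0, T[ -> 0 <= v t.
Proof.
move=> eps0 g_le0 f_gt v_at0 [v_lsc v_super] t; rewrite in_itv/= => /andP[t0 tT].
rewrite leNgt; apply/negP => vt0.
pose t1 := (t + T) / 2.
have [tt1 t1T] : t < t1 /\ t1 < T by rewrite /t1; split; lra.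
have t10 : 0 < t1 by lra.
(* With this [k], [- k < v s0] makes the product at [s0] exceed its value at [t]; at [t1] it
   vanishes while it is negative at [t]. Neither endpoint is a minimum point. *)
pose k := - v t * (t1 - t) / t1.
have k0 : 0 < k by rewrite /k divr_gt0// mulr_gt0//; lra.
have kt1 : k * t1 = - v t * (t1 - t) by rewrite /k divfK// gt_eqF.
have [s0 [s00 s0t vs0]] : exists s0, [/\ 0 < s0, s0 < t & - k < v s0].
  near (0 : R)^'+ => s0; exists s0; split.
  - by near: s0; exact: nbhs_right_gt.
  - by near: s0; exact: nbhs_right_lt.
- by near: s0; exact: v_at0.
have {k0 kt1}hs0 : v t * (t1 - t) < v s0 * (t1 - s0).
  have : 0 < (v s0 + k) * (t1 - s0) by rewrite mulr_gt0//; lra.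
  have : 0 < k * s0 by rewrite mulr_gt0.
  by rewrite mulrDl (mulrBr k) kt1; lra.
have {}vt0 : v t * (t1 - t) < 0 by rewrite pmulr_llt0// subr_gt0.
have [||p pI p_min] := @compact_lsc_min _ (fun s => v s * (t1 - s)) s0 t1.
- by lra.
- move=> p; rewrite in_itv/= => /andP[s0p pt1] c cp.
  have pT : p \in `]0, T[ by rewrite in_itv/=; apply/andP; split; lra.
  (* A value [d] below [v p] separates the factors: [v s > d] near [p] by semicontinuity, and
     [d * (t1 - s)] is continuous. *)
  have [d dv cd] : exists2 d, d < v p & c < d * (t1 - p).
    have [pt1'|pt1'] := ltP p t1.
      exists ((v p + c / (t1 - p)) / 2).
        have : c / (t1 - p) < v p by rewrite ltr_pdivrMr// subr_gt0.
        by lra.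
      have := divfK (lt0r_neq0 (_ : 0 < t1 - p)) c.
      rewrite subr_gt0 => /(_ pt1') ceq.
      rewrite mulrDl mulrDl; lra.
    have pe : p = t1 by lra.
    exists (v p - 1); first by lra.
    by move: cp; rewrite pe subrr !mulr0.
  have cont : (fun s => d * (t1 - s)) @ p --> d * (t1 - p).
    by apply: cvgM; [exact: cvg_cst|apply: cvgB; [exact: cvg_cst|exact: cvg_id]].
  near=> s => /itvP sI; apply: (@lt_le_trans _ _ (d * (t1 - s))).
    by near: s; exact: (cvgr_gt _ cont).
  rewrite ler_wpM2r// ?subr_ge0 ?sI// ltW//; near: s; exact: v_lsc.
have ht : v p * (t1 - p) <= v t * (t1 - t).
  by apply: p_min; rewrite in_itv/=; apply/andP; split; lra.
move: pI; rewrite in_itv/= => /andP[s0p pt1].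
have {}s0p : s0 < p.
  by rewrite lt_neqAle s0p andbT; apply/eqP => pe; move: hs0; rewrite pe; lra.
have {}pt1 : p < t1.
  rewrite lt_neqAle pt1 andbT; apply/eqP => pe.
  by move: ht; rewrite pe subrr mulr0; lra.
have pT : p \in `]0, T[ by rewrite in_itv/=; apply/andP; split; lra.
have t1p : 0 < t1 - p by rewrite subr_gt0.
have vp0 : v p < 0 by rewrite -(pmulr_llt0 _ t1p); exact: le_lt_trans ht vt0.
have b0 : v p / (t1 - p) < 0 by rewrite pmulr_llt0 ?invr_gt0.
pose phi s := (v p * (t1 - p)) / (t1 - s).
have dphi : is_derive p 1 phi (v p / (t1 - p)).
  have d1 : is_derive p 1 (fun s : R => t1 - s) (-1).
    rewrite -sub0r.
    exact: is_deriveB (is_derive_cst t1 p 1) (is_derive_id p 1).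
  have d2 := @is_deriveV _ (fun s => t1 - s) _ _ _ (lt0r_neq0 t1p) d1.
  have d3 := is_deriveZ (v p * (t1 - p)) d2.
  apply: (is_derive_eq d3); rewrite /GRing.scale /=.
  by field; rewrite gt_eqF.
have vb : subjet v p (v p / (t1 - p)).
  apply: (@subjet_ge_is_derive _ v phi p _ dphi); first by rewrite /phi mulfK// gt_eqF.
  near=> s.
  have sI : s \in `]s0, t1[ by near: s; apply: near_in_itvoo; rewrite in_itv/= s0p.
  rewrite /phi ler_pdivrMr ?subr_gt0 ?(itvP sI)//.
  by apply: p_min; exact: subset_itv_oo_cc.
(* A negative slope forces [nu = -1], so the supersolution inequality would give [f p <= -1]. *)
have [nu /(subdiffR_lt0 b0)-> ] := v_super p pT _ vb.
have := g_le0 _ vp0; have := f_gt _ pT.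
have : eps * (v p / (t1 - p)) <= 0 by rewrite mulr_ge0_le0// ltW.
by lra.
Unshelve. all: by end_near. Qed.

(* The parabola [h p - K * (s - t) ^+ 2] touches [v] from below at a point
   [p] near [t] where [v p <= x], and its slope is at most [2 * (x + 1) / eta]. *)
Lemma visc_supersol_ge (R : realType) (T eps : R) (g f v : R -> R)
    (t x eta delta : R) :
  0 <= eps -> 0 < eta -> 0 < t - eta -> t + eta < T -> 0 <= x ->
  (forall s y, s \in `[t - eta, t + eta] -> y \in `[0, x] ->
     delta <= f s - 1 - g y) ->
  eps * (2 * ((x + 1) / eta)) < delta ->
  visc_supersol T eps g f v -> (forall s, s \in `]0, T[ -> 0 <= v s) ->
  x <= v t.
Proof.
move=> eps0 eta0 teta etaT x0 gap eps_small [v_lsc v_super] v0.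
rewrite leNgt; apply/negP => vtx.
(* At distance [eta] from [t] the parabola term equals [x + 1 > v t]; since [v >= 0], the minimum of
   [h] is interior. *)
pose K := (x + 1) / eta ^+ 2.
have eta2 : 0 < eta ^+ 2 by rewrite exprn_gt0.
have K0 : 0 < K by rewrite divr_gt0//; lra.
have Keta2 : K * eta ^+ 2 = x + 1 by rewrite /K divfK// gt_eqF.
have Keta : K * eta = (x + 1) / eta by rewrite /K; field; rewrite gt_eqF.
pose h s := v s + K * (s - t) ^+ 2.
have inT p : p \in `[t - eta, t + eta] -> p \in `]0, T[.
  by rewrite !in_itv/= => /andP[? ?]; apply/andP; split; lra.
have [||p pI p_min] := @compact_lsc_min _ h (t - eta) (t + eta).
- by lra.
- move=> p pI c; rewrite /h => cp.
  have c1 : (fun s => K * (s - t) ^+ 2) @ p --> K * (p - t) ^+ 2.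
    apply: cvgM; first exact: cvg_cst.
    by apply: (@cvgM _ _ (nbhs p)); apply: cvgB; (exact: cvg_cst || exact: cvg_id).
  pose d := (v p + K * (p - t) ^+ 2 - c) / 2.
  have vpd : v p - d < v p by rewrite /d; lra.
  have kpd : K * (p - t) ^+ 2 - d < K * (p - t) ^+ 2 by rewrite /d; lra.
  near=> s => _.
  have vs : v p - d < v s by near: s; exact: (v_lsc _ (inT _ pI)).
  have ks : K * (p - t) ^+ 2 - d < K * (s - t) ^+ 2.
    by near: s; exact: (cvgr_gt _ c1).
  by move: vs ks; rewrite /d; lra.
have ht : h p <= v t.
  have -> : v t = h t by rewrite /h subrr expr0n mulr0 addr0.
  by apply: p_min; rewrite in_itv/=; apply/andP; split; lra.
have pT := inT _ pI.
have vp0 := v0 _ pT.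
move: (pI); rewrite in_itv/= => /andP[].
rewrite le_eqVlt => /predU1P[pe|tp].
  by move: ht; rewrite /h (_ : p - t = - eta) ?sqrrN ?Keta2; lra.
rewrite le_eqVlt => /predU1P[pe|pt].
  by move: ht; rewrite /h (_ : p - t = eta) ?Keta2; lra.
have K2 : 0 <= K * (p - t) ^+ 2 by rewrite mulr_ge0 ?sqr_ge0 ?ltW.
have vpx : v p <= x by move: ht; rewrite /h; lra.
pose phi s := h p - K * (s - t) ^+ 2.
have dphi : is_derive p 1 phi (- (K * 2 * (p - t))).
  have d1 : is_derive p 1 (fun s : R => s - t) 1.
    apply: (is_derive_eq (is_deriveB (is_derive_id p 1) (is_derive_cst t p 1))).
    exact: subr0.
  have d2 := is_deriveZ K (@is_deriveX _ _ (fun s => s - t) 2 _ _ _ d1).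
  have d3 := is_deriveB (is_derive_cst (h p) p 1) d2.
  by apply: (is_derive_eq d3); rewrite /GRing.scale /=; ring.
have vb : subjet v p (- (K * 2 * (p - t))).
  apply: (@subjet_ge_is_derive _ v phi p _ dphi); first by rewrite /phi /h addrK.
  near=> s; rewrite /phi lerBlDr; apply: p_min.
  apply: subset_itv_oo_cc; near: s; apply: near_in_itvoo.
  by rewrite in_itv/= tp.
(* As [nu <= 1], the viscous term bounds [f p - 1 - g (v p)] from above; it is smaller than [delta]
   because [p] is within [eta] of [t]. *)
have [nu /subdiffR_le1 nu1] := v_super p pT _ vb.
have vpI : v p \in `[0, x] by rewrite in_itv/= vp0.
have := gap p (v p) pI vpI.
have : eps * - (K * 2 * (p - t)) <= eps * (2 * ((x + 1) / eta)).
  rewrite ler_wpM2l// -Keta.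
  have : 0 <= K * (eta + (p - t)) by rewrite mulr_ge0//; lra.
  by rewrite mulrDr; lra.
by lra.
Unshelve. all: by end_near. Qed.

Lemma continuous_itv_lt_gap (R : realType) (g : R -> R) (x c : R) :
  continuous g -> 0 <= x -> (forall y, y \in `[0, x] -> g y < c) ->
  exists2 d, 0 < d & forall y, y \in `[0, x] -> g y <= c - d.
Proof.
move=> g_cont x0 g_lt.
have [y yI y_max] := EVT_max x0 (continuous_subspaceT g_cont).
exists (c - g y); first by rewrite subr_gt0 g_lt.
by move=> z zI; rewrite subKr y_max.
Qed.

(** The threshold [eps0] does not depend on [v], so the same barrier serves [eps = 0] and every
    small viscosity. *)
Lemma visc_supersol_ge_near0 (R : realType) (T : R) (g f : R -> R) (t x : R) :
  continuous g -> t \in `]0, T[ -> {for t, continuous f} -> 0 <= x ->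
  (forall y, y \in `[0, x] -> g y < f t - 1) ->
  exists2 eps0, 0 < eps0 & forall eps v, 0 <= eps < eps0 ->
    visc_supersol T eps g f v -> (forall s, s \in `]0, T[ -> 0 <= v s) ->
    x <= v t.
Proof.
move=> g_cont tT f_cont x0 /(continuous_itv_lt_gap g_cont x0)[d d0 gd].
have : \forall s \near t, (s \in `]0, T[) /\ f t - d / 2 < f s.
  near=> s; split; first by near: s; exact: near_in_itvoo.
  by near: s; apply: (cvgr_gt _ f_cont); lra.
move=> /nbhs_ballP[r /= r0 tr].
pose eta := r / 2.
have eta0 : 0 < eta by rewrite divr_gt0.
have etar s : s \in `[t - eta, t + eta] -> (s \in `]0, T[) /\ f t - d / 2 < f s.
  rewrite in_itv/= => /andP[ts st]; apply: tr.
  by rewrite /ball/= ltr_distlC; apply/andP; rewrite /eta in ts st; split; lra.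
have x10 : 0 < 2 * ((x + 1) / eta) by rewrite mulr_gt0// divr_gt0//; lra.
(* Half of the gap [d] absorbs the variation of [f] near [t]; the other half dominates [eps] times
   the steepest slope of the parabola. *)
exists (d / 2 / (2 * ((x + 1) / eta))); first by rewrite !divr_gt0.
move=> eps v /andP[eps0 eps_lt] v_super v0.
apply: (@visc_supersol_ge _ T eps g f v t x eta (d / 2)) => //.
- have [|+ _] := etar (t - eta); rewrite in_itv/=; last by case/andP.
  by apply/andP; split; lra.
- have [|+ _] := etar (t + eta); rewrite in_itv/=; last by case/andP.
  by apply/andP; split; lra.
- by move=> s y /etar[_ fs] /gd; lra.
- by rewrite -ltr_pdivlMr.
Unshelve. all: by end_near. Qed.

(** * Lipschitz estimates and the upper bound for viscous subsolutions *)

Lemma lipschitz_nbhs_continuous (R : realType) (g : R -> R) (x : R) (U : set R) :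
  nbhs x U -> [lipschitz g y | y in U] -> {for x, continuous g}.
Proof.
move=> xU [k [_ /(_ (`|k| + 1))]].
rewrite (le_lt_trans (ler_norm k)) ?ltrDl// => /(_ isT) gU.
apply/cvgrPdist_lt => eps eps0.
have k0 : 0 < `|k| + 1 by rewrite ltr_wpDl.
near=> y.
have /= := gU (x, y); move=> /(_ _)/le_lt_trans; apply.
  by split=> /=; [exact: nbhs_singleton|near: y].
rewrite -ltr_pdivlMl// mulrC; near: y.
by apply: (@cvgr_dist_lt _ _ _ (nbhs x)); [exact: cvg_id|rewrite divr_gt0].
Unshelve. all: by end_near. Qed.

Lemma locally_lipschitz_continuous (R : realType) (g : R -> R) :
  locally_lipschitz g -> continuous g.
Proof. by move=> g_lip x; have [U] := g_lip x; exact: lipschitz_nbhs_continuous. Qed.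

(* Away from [x], boundedness of [g] replaces the Lipschitz condition. *)
Lemma locally_lipschitz_lower (R : realType) (g : R -> R) (x M : R) :
  locally_lipschitz g -> x <= M ->
  exists2 L, 0 <= L & forall y, y \in `[x, M] -> g x - g y <= L * (y - x).
Proof.
move=> g_lip xM; have g_cont := locally_lipschitz_continuous g_lip.
have [z zI z_min] := EVT_min xM (continuous_subspaceT g_cont).
have [U /nbhs_ballP[r /= r0 rU] [k [_ /(_ (`|k| + 1))]]] := g_lip x.
rewrite (le_lt_trans (ler_norm k)) ?ltrDl// => /(_ isT) gU.
have gzx : 0 <= g x - g z by rewrite subr_ge0 z_min// in_itv/= lexx.
exists (Num.max (`|k| + 1) ((g x - g z) / r)); first by rewrite le_max addr_ge0.
move=> y yI; have xy : 0 <= y - x by rewrite subr_ge0 (itvP yI).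
have [yr|ry] := ltP (y - x) r.
  apply: (@le_trans _ _ ((`|k| + 1) * (y - x))).
    apply: le_trans (ler_norm _) _; rewrite -[y - x]ger0_norm // distrC.
    apply: (gU (y, x)); split=> /=; last exact/rU/ballxx.
    by apply: rU; rewrite /ball/= distrC ger0_norm.
  by rewrite ler_wpM2r// le_max lexx.
apply: (@le_trans _ _ ((g x - g z) / r * (y - x))).
  have gyz : g x - g y <= g x - g z by rewrite lerB// z_min.
  apply: (le_trans gyz); rewrite mulrAC ler_pdivlMr//.
  by rewrite ler_wpM2l.
by rewrite ler_wpM2r// le_max lexx orbT.
Qed.

(* With [eps * K = L], the maximum of [(w s - x) * (t - s) * exp (- K * s)] is
   attained where [w] has a superjet larger than [K * (w - x)]: this is
   Gronwall's inequality for viscosity subsolutions. *)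
Lemma visc_subsol_le (R : realType) (T eps : R) (g f w : R -> R) (t x : R) :
  0 < eps -> locally_lipschitz g -> w 0 <= x ->
  {within `[0, T[, continuous w} -> t \in `]0, T[ ->
  (forall s, s \in `]0, t[ -> f s - 1 <= g x) ->
  visc_subsol T eps g f w -> w t <= x.
Proof.
move=> eps0 g_lip w0x w_cont tT fg [_ w_sub].
have t0 : 0 < t by rewrite (itvP tT).
rewrite leNgt; apply/negP => xwt.
have wt_cont : {within `[0, t], continuous w}.
  apply: continuous_subspaceW w_cont => s /=; rewrite !in_itv/= => /andP[-> st].
  by rewrite (le_lt_trans st)// (itvP tT).
have [_ _ wt_left] := (continuous_within_itvP w t0).1 wt_cont.
(* The weight in [rho] vanishes at [t], so positivity of [rho] is witnessed earlier, by continuity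
   from the left. *)
have [s0 [s00 s0t xs0]] : exists s0, [/\ 0 < s0, s0 < t & x < w s0].
  near t^'- => s0; exists s0; split.
  - by near: s0; exact: nbhs_left_gt.
  - by near: s0; exact: nbhs_left_lt.
  - by near: s0; exact: (cvgr_gt _ wt_left).
have [M MI wM] := EVT_max (ltW t0) wt_cont.
have xM : x <= w M by apply/ltW/(lt_le_trans xs0)/wM; rewrite in_itv/= !ltW.
have [L L0 gL] := locally_lipschitz_lower g_lip xM.
pose K := L / eps.
have epsK : eps * K = L by rewrite /K mulrC divfK// gt_eqF.
have K0 : 0 <= K by rewrite divr_ge0// ltW.
pose rho s := (w s - x) * ((t - s) * expR (- (K * s))).
have rho_cont : {within `[0, t], continuous rho}.
  move=> s; apply: cvgM.
    by apply: cvgB; [exact: wt_cont|exact: cvg_cst].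
  have fact_cont : continuous (fun s : R => (t - s) * expR (- (K * s))).
    move=> z; apply: cvgM.
      by apply: cvgB; [exact: cvg_cst|exact: cvg_id].
    apply: (@cvg_comp _ _ _ (fun s => - (K * s)) expR _ (nbhs (- (K * z)))).
      by apply: cvgN; apply: cvgM; [exact: cvg_cst|exact: cvg_id].
    exact: continuous_expR.
  exact: (continuous_subspaceT fact_cont).
have [p pI p_max] := EVT_max (ltW t0) rho_cont.
have rho_p : 0 < rho p.
  apply: (@lt_le_trans _ _ (rho s0)).
    by rewrite !mulr_gt0 ?subr_gt0// expR_gt0.
  by apply: p_max; rewrite in_itv/= !ltW.
have pt : p < t.
  rewrite lt_neqAle (itvP pI) andbT; apply: contraPneq rho_p => ->.
  by rewrite /rho subrr mul0r mulr0 ltxx.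
have tp0 : 0 < t - p by rewrite subr_gt0.
have wpx : x < w p.
  by move: rho_p; rewrite /rho pmulr_lgt0 ?subr_gt0// mulr_gt0// expR_gt0.
have p0 : 0 < p.
  rewrite lt_neqAle (itvP pI) andbT; apply: contraPneq wpx => <-.
  by rewrite ltNge w0x.
have pT : p \in `]0, T[ by rewrite in_itv/= p0 (lt_trans pt)// (itvP tT).
(* [phi] is the curve along which [rho] would keep the value [rho p]; thus [w <= phi] near [p]
   restates maximality. *)
pose phi s := x + rho p * (expR (K * s) * (t - s)^-1).
have rhoE s : s < t -> w s = x + rho s * (expR (K * s) * (t - s)^-1).
  move=> st; rewrite /rho expRN; field.
  by rewrite !lt0r_neq0 ?subr_gt0 ?expR_gt0.
have dphi : is_derive p 1 phi ((w p - x) * (K + (t - p)^-1)).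
  have d1 : is_derive p 1 (fun s : R => t - s) (-1).
    apply: (is_derive_eq (is_deriveB (is_derive_cst t p 1) (is_derive_id p 1))).
    exact: sub0r.
  have d2 := @is_deriveV _ (fun s => t - s) _ _ _ (lt0r_neq0 tp0) d1.
  have d3 := is_derive1_comp (is_derive_expR (K * p)) (is_deriveZ K (is_derive_id p 1)).
  have d4 := is_deriveD (is_derive_cst x p 1) (is_deriveZ (rho p) (is_deriveM d3 d2)).
  apply: (is_derive_eq d4); rewrite [in RHS](rhoE _ pt) /GRing.scale /=.
  by field; rewrite gt_eqF.
have wa : superjet w p ((w p - x) * (K + (t - p)^-1)).
  apply: (@superjet_le_is_derive _ w phi p _ dphi); first exact: rhoE.
  near=> s.
  have sI : s \in `]0, t[ by near: s; apply: near_in_itvoo; rewrite in_itv/= p0.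
  rewrite rhoE ?(itvP sI)// lerD2l ler_pM2r; last first.
    by rewrite mulr_gt0 ?expR_gt0// invr_gt0 subr_gt0 (itvP sI).
  by apply: p_max; exact: subset_itv_oo_cc.
have wpx0 : 0 < w p - x by rewrite subr_gt0.
have a0 : 0 < (w p - x) * (K + (t - p)^-1).
  by rewrite mulr_gt0// ltr_wpDl// invr_gt0.
have [mu /(subdiffR_gt0 a0)->] := w_sub p pT _ wa.
have := fg p; rewrite in_itv/= p0 pt => /(_ isT).
have := gL (w p); rewrite in_itv/= ltW// wM// => /(_ isT).
(* The part [L * (w p - x)] of the slope term pays for the drop of [g] from [x] to [w p]; this
   strictly positive rest gives the contradiction. *)
have : 0 < eps * ((w p - x) * (t - p)^-1) by rewrite !mulr_gt0// invr_gt0.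
have -> : eps * ((w p - x) * (K + (t - p)^-1)) =
    L * (w p - x) + eps * ((w p - x) * (t - p)^-1) by rewrite -epsK; ring.
by lra.
Unshelve. all: by end_near. Qed.

(** * The rest level as a function of the forcing *)

(* The first level at which a solution increasing from [0] can rest when the
   forcing is [c]. *)
Definition level (R : realType) (g : R -> R) (c : R) : R :=
  inf [set x | 0 <= x /\ c <= g x].

Section level.
Variables (R : realType) (g : R -> R).
Hypotheses (g_cont : continuous g) (g_pinfty : g r @[r --> +oo] --> +oo).

Lemma level_le c x : 0 <= x -> c <= g x -> level g c <= x.
Proof. by move=> x0 cg; apply: ge_inf => //; exists 0 => y /= []. Qed.

Lemma lt_level c x y : x < level g c -> y \in `[0, x] -> g y < c.
Proof.
move=> xl /itvP yI; rewrite ltNge; apply/negP => /(level_le _).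
by rewrite yI => /(_ isT)/(lt_le_trans xl); rewrite ltNge yI.
Qed.

Lemma level_ex c : [set x | 0 <= x /\ c <= g x] !=set0.
Proof.
have /cvgryPge/(_ c) g_ge := g_pinfty.
near (pinfty_nbhs R) => x; exists x; split; last by near: x.
by near: x; apply: nbhs_pinfty_ge; rewrite num_real.
Unshelve. all: by end_near. Qed.

Lemma le_level c z : (forall x, 0 <= x -> c <= g x -> z <= x) -> z <= level g c.
Proof.
move=> zP; apply: lb_le_inf; first exact: level_ex.
by move=> x /= [x0 cx]; exact: zP.
Qed.

Lemma level_ge0 c : 0 <= level g c.
Proof. exact: le_level. Qed.

(** Were [g] below [c] at the infimum, continuity would keep it below [c] on a stretch to the right,
    and the infimum would be larger. *)
Lemma level_reached c : c <= g (level g c).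
Proof.
rewrite leNgt; apply/negP => gl.
have [r /= r0 lr] := (nbhs_ballP _ _).1 (cvgr_lt _ (@g_cont (level g c)) _ gl).
suff : level g c + r / 2 <= level g c by lra.
apply: le_level => x x0 cx; rewrite leNgt; apply/negP => xl.
have lx := level_le x0 cx.
have : g x < c by apply: lr; rewrite /ball/= ltr_distlC; lra.
by rewrite ltNge cx.
Qed.

Lemma level_homo c c' : c <= c' -> level g c <= level g c'.
Proof.
by move=> cc; apply: level_le; [exact: level_ge0|exact: le_trans (level_reached c')].
Qed.

Lemma level_le_approx c z :
  0 <= z -> (forall x, 0 <= x -> x < level g c -> x <= z) -> level g c <= z.
Proof.
move=> z0 zP; rewrite leNgt; apply/negP => zl.
by have := zP ((z + level g c) / 2); lra.
Qed.

(** Up to a point strictly between [z] and the level, [g] stays below [c] by a uniform margin, which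
    survives a small change of [c]. *)
Lemma level_lsc c z : z < level g c -> \forall d \near c, z < level g d.
Proof.
move=> zl; have [z0|z0] := ltP z 0.
  by near=> d; exact: lt_le_trans (level_ge0 d).
pose x := (z + level g c) / 2.
have xl : x < level g c by rewrite /x; lra.
have [|eps eps0 gx] := @continuous_itv_lt_gap _ g x c g_cont _ (fun y => lt_level xl).
  by rewrite /x; lra.
near=> d; apply: (@lt_le_trans _ _ x); first by rewrite /x; lra.
apply: le_level => y y0 dy; rewrite leNgt; apply/negP => yx.
have := gx y; rewrite in_itv/= y0 ltW// => /(_ isT).
suff : c - eps < d by lra.
by near: d; apply: (@cvgr_gt _ _ (nbhs c) _ id c); [exact: cvg_id|lra].
Unshelve. all: by end_near. Qed.

(** A nondecreasing function has no negative slope in its subjets, so [nu = 1] is always allowed and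
    the inequality becomes [level_reached]. *)
Lemma level_visc_supersol (T : R) (f : R -> R) :
  {in `]0, T[, continuous f} -> {in `]0, T[ &, {homo f : s t / s < t}} ->
  visc_supersol T 0 g f (fun t => level g (f t - 1)).
Proof.
move=> f_cont f_incr; split=> t tT.
  move=> c cl; have /= := level_lsc cl; apply: (cvgB (f_cont t tT) (cvg_cst (1 : R))).
move=> b [a /superjetP wa ab]; exists 1; last first.
  by rewrite mul0r add0r -lerBlDl; exact: level_reached.
apply: subdiffR1; rewrite leNgt; apply/negP => b0.
have a0 : 0 < a by lra.
have a20 : 0 < a / 2 by rewrite divr_gt0.
(* With this error term half of the slope survives to the left of [t], where the level would exceed
   its value at [t]. *)
have : \forall s \near t, (s \in `]0, T[) /\
    - level g (f s - 1) <= - level g (f t - 1) + a * (s - t) + a / 2 * `|s - t|.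
  near=> s; split; first by near: s; exact: near_in_itvoo.
  by near: s; exact: wa.
move=> /nbhs_ballP[r /= r0 tr].
pose s := t - r / 2.
have [|sT] := tr s; first by rewrite /ball/= /s opprB addrC subrK gtr0_norm; lra.
have st : s < t by rewrite /s; lra.
have /level_homo : f s - 1 <= f t - 1 by rewrite lerB// ltW// f_incr.
rewrite ltr0_norm ?subr_lt0//.
have : 0 < a * (t - s) by rewrite mulr_gt0// subr_gt0.
by lra.
Unshelve. all: by end_near. Qed.

End level.

(** * Sign of the nonlinearity and its monotone minorant *)

Section minorant.
Variables (R : realType) (g : R -> R).
Hypotheses (g_cont : continuous g) (g_zero : forall r, g r = 0 <-> r = 0).

(** A nonpositive value at [x > 0] and the growth at infinity would create a positive zero. *)
Lemma zero_unique_gt0 (g_pinfty : g r @[r --> +oo] --> +oo) x : 0 < x -> 0 < g x.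
Proof.
move=> x0; rewrite ltNge; apply/negP => gx.
have /cvgryPgt/(_ 0) g_ge := g_pinfty.
near (pinfty_nbhs R) => y.
have xy : x <= y by near: y; apply: nbhs_pinfty_ge; rewrite num_real.
have gy : 0 < g y by near: y.
have [|c cI /g_zero c0] := @IVT _ _ _ _ 0 xy (continuous_subspaceT g_cont).
  by rewrite ge_min gx le_max (ltW gy) orbT.
by move: cI; rewrite c0 in_itv/= leNgt x0.
Unshelve. all: by end_near. Qed.

Lemma zero_unique_lt0 (g_ninfty : g r @[r --> -oo] --> -oo) x : x < 0 -> g x < 0.
Proof.
move=> x0; rewrite ltNge; apply/negP => gx.
have /cvgrNyPlt/(_ 0) g_le := g_ninfty.
near (ninfty_nbhs R) => y.
have yx : y <= x by near: y; apply: nbhs_ninfty_le; rewrite num_real.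
have gy : g y < 0 by near: y.
have [|c cI /g_zero c0] := @IVT _ _ _ _ 0 yx (continuous_subspaceT g_cont).
  by rewrite ge_min (ltW gy) le_max gx orbT.
by move: cI; rewrite c0 in_itv/= (leNgt 0) x0 andbF.
Unshelve. all: by end_near. Qed.

(** Bounding [sup] requires that some increasing minorant exist. The running infimum of [g] over
    [[z, +oo)] is one; it is finite since [g] is nonnegative on the right and has a minimum on
    [[z, 0]] if [z <= 0]. *)
Lemma monotone_minorant_le x :
  (forall y, 0 < y -> 0 <= g y) -> monotone_minorant g x <= g x.
Proof.
move=> g_ge0; apply: ge_sup; last by move=> _ [m [_ mg] <-].
pose up z := [set g y | y in [set y | z <= y]].
have up_lb z : has_lbound (up z).
  have [z0|z0] := ltP 0 z.
    by exists 0 => _ [y /= zy <-]; apply/g_ge0/(lt_le_trans z0).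
  have [c cI c_min] := EVT_min z0 (continuous_subspaceT g_cont).
  exists (Num.min (g c) 0) => _ [y /= zy <-]; rewrite ge_min.
  have [y0|/g_ge0->] := leP y 0; last exact: orbT.
  by rewrite c_min// in_itv/= zy.
exists (inf (up x)); exists (inf \o up) => //; split=> [y z yz|y] /=.
  apply: lb_le_inf; first by exists (g z); exists z => /=.
  by move=> _ [w /= zw <-]; apply: ge_inf => //; exists w => //=; exact: le_trans zw.
by apply: ge_inf => //; exists y => /=.
Qed.

End minorant.

(** * Behaviour near time zero *)

Lemma visc_ivp_sol_cvg0 (R : realType) (T eps : R) (g f w : R -> R) :
  0 < T -> visc_ivp_sol T eps g f w -> w s @[s --> 0^'+] --> (0 : R).
Proof.
move=> T0 [w_cont w0 _]; have T20 : 0 < T / 2 by rewrite divr_gt0.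
have wT_cont : {within `[0, T / 2], continuous w}.
  apply: continuous_subspaceW w_cont => s /=; rewrite !in_itv/= => /andP[-> st].
  by rewrite (le_lt_trans st)//; lra.
by have [_ + _] := (continuous_within_itvP w T20).1 wT_cont; rewrite w0.
Qed.

Lemma differentiable_co_cvg0 (R : realType) (T : R) (w : R -> R) :
  differentiable_co T w -> w 0 = 0 -> w s @[s --> 0^'+] --> (0 : R).
Proof.
move=> [_ /cvg_ex[/= l wl]] w0.
have : (w s - w 0) / s * s @[s --> 0^'+] --> l * 0.
  by apply: cvgM => //; apply: cvg_at_right_filter; exact: cvg_id.
rewrite mulr0; apply: cvg_trans; apply: near_eq_cvg; near=> s.
have s0 : 0 < s by near: s; exact: nbhs_right_gt.
by rewrite divfK ?gt_eqF// w0 subr0.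
Unshelve. all: by end_near. Qed.

Lemma homo_lt_gt_right_limit (R : realType) (T : R) (f : R -> R) :
  {in `]0, T[ &, {homo f : s t / s < t}} -> f s @[s --> 0^'+] --> f 0 ->
  forall t, t \in `]0, T[ -> f 0 < f t.
Proof.
move=> f_incr f_at0 t tT; have /andP[t0 tlT] : 0 < t < T by rewrite !(itvP tT).
(* The midpoint turns the weak inequality obtained in the limit into a strict one. *)
have hT : t / 2 \in `]0, T[ by rewrite in_itv/=; apply/andP; split; lra.
apply: (@le_lt_trans _ _ (f (t / 2))); last by apply: f_incr => //; lra.
rewrite leNgt; apply/negP => fh.
near (0 : R)^'+ => s.
have s0 : 0 < s by near: s; exact: nbhs_right_gt.
have st : s < t / 2 by near: s; apply: nbhs_right_lt; rewrite divr_gt0.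
have fs : f (t / 2) < f s by near: s; exact: (cvgr_gt _ f_at0).
have sT : s \in `]0, T[ by rewrite in_itv/= s0; lra.
by have := f_incr _ _ sT hT st; lra.
Unshelve. all: by end_near. Qed.

(** * Comparison of supersolutions, [u_vis] and the envelope with the level *)

Lemma visc_supersol0_ge_level (R : realType) (T : R) (g f v : R -> R) :
  continuous g -> {in `]0, T[, continuous f} -> visc_supersol T 0 g f v ->
  (forall t, t \in `]0, T[ -> 0 <= v t) ->
  forall t, t \in `]0, T[ -> level g (f t - 1) <= v t.
Proof.
move=> g_cont f_cont v_super v_ge0 t tT.
apply: level_le_approx; first exact: v_ge0.
move=> x x0 xl.
have [eps0 eps00 /(_ 0 v)] := visc_supersol_ge_near0 g_cont tT (f_cont t tT) x0
  (fun y => lt_level xl).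
by rewrite lexx; apply.
Qed.

(** If [g (v t) < f t - 1], continuity and monotonicity extend this to [[0, v t + r / 2]], and the
    barrier gives the absurd [v t + r / 2 <= v t]. Applied to [m] and [hi], this places the level
    below [hi]. *)
Lemma visc_supersol0_homo_ge (R : realType) (T : R) (g f v : R -> R) :
  continuous g -> {homo g : x y / x < y} -> {in `]0, T[, continuous f} ->
  visc_supersol T 0 g f v -> (forall t, t \in `]0, T[ -> 0 <= v t) ->
  forall t, t \in `]0, T[ -> f t - 1 <= g (v t).
Proof.
move=> g_cont g_incr f_cont v_super v_ge0 t tT.
rewrite leNgt; apply/negP => gv.
have [r /= r0 vr] := (nbhs_ballP _ _).1 (cvgr_lt _ (@g_cont (v t)) _ gv).
pose x := v t + r / 2.
have x0 : 0 <= x by rewrite /x addr_ge0 ?v_ge0// divr_ge0// ltW.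
have gx : g x < f t - 1 by apply: vr; rewrite /ball/= ltr_distlC /x; lra.
have [|eps0 eps00 /(_ 0 v)] := visc_supersol_ge_near0 g_cont tT (f_cont t tT) x0.
  move=> y /itvP yI; apply: le_lt_trans gx.
  by have := ltW_homo g_incr; apply; rewrite yI.
rewrite lexx => /(_ eps00 v_super v_ge0); rewrite /x; lra.
Qed.

Lemma u_vis_level (R : realType) (T : R) (e f : R -> R) (u : R -> R -> R) :
  locally_lipschitz e -> e r @[r --> +oo] --> +oo ->
  {in `]0, T[, continuous f} -> {in `]0, T[ &, {homo f : s t / s < t}} ->
  (forall eps, 0 < eps -> visc_ivp_sol T eps e f (u eps)) ->
  (forall eps, 0 < eps -> forall t, t \in `]0, T[ -> 0 <= u eps t) ->
  forall t, t \in `]0, T[ -> u_vis u t = (level e (f t - 1))%:E.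
Proof.
move=> e_lip e_pinfty f_cont f_incr u_sol u_ge0 t tT.
have e_cont := locally_lipschitz_continuous e_lip.
apply/eqP; rewrite eq_le; apply/andP; split.
  apply: ge_ereal_sup => _ [eps /= eps0 <-]; rewrite lee_fin.
  have [u_cont u0 [_ u_sub _]] := u_sol _ eps0.
  apply: (visc_subsol_le eps0 e_lip _ u_cont tT _ u_sub).
    by rewrite u0; exact: level_ge0.
  move=> s sI; apply: le_trans (level_reached e_cont e_pinfty _).
  have [s0 st] : 0 < s /\ s < t by rewrite !(itvP sI).
  by rewrite lerB// ltW// f_incr// in_itv/= s0 (lt_trans st)// (itvP tT).
have sup_ge eps : 0 < eps -> ((u eps t)%:E <= u_vis u t)%E.
  by move=> eps0; apply: ereal_sup_ubound; exists eps.
(* The member [eps = 1] excludes the value [-oo] and makes a finite supremum nonnegative. *)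
have u1 : ((u 1 t)%:E <= u_vis u t)%E by exact: sup_ge.
have := u_ge0 _ ltr01 _ tT.
move: u1 sup_ge; case: (u_vis u t) => [z| _ _ _|//]; last by rewrite leey.
rewrite !lee_fin => u1 sup_ge u1_ge0.
apply: level_le_approx; first exact: le_trans u1.
move=> x x0 xl.
have [eps0 eps00 u_ge] := visc_supersol_ge_near0 e_cont tT (f_cont t tT) x0
  (fun y => lt_level xl).
have eps20 : 0 < eps0 / 2 by rewrite divr_gt0.
have [_ _ [_ _ u_super]] := u_sol _ eps20.
have := sup_ge _ eps20; rewrite lee_fin; apply: le_trans.
apply: (u_ge _ _ _ u_super (u_ge0 _ eps20)); lra.
Qed.

(** As [t] lies in each of its neighbourhoods, the envelope is at most [w t]; the neighbourhoods
    where [w > w t - eps] give the converse. *)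
Lemma lsc_env_id (R : realType) (T : R) (V : R -> \bar R) (w : R -> R) :
  (forall t, t \in `]0, T[ -> V t = (w t)%:E) -> lsc_on T w ->
  forall t, t \in `]0, T[ -> lsc_env T V t = (w t)%:E.
Proof.
move=> Vw w_lsc t tT; rewrite /lsc_env limf_einfE.
apply/eqP; rewrite eq_le; apply/andP; split.
  apply: ge_ereal_sup => _ [A /= At <-]; apply: ereal_inf_lbound.
  exists t; last exact: Vw.
  exact: (nbhs_singleton At).
apply/lee_subgt0Pr => eps eps0; rewrite -EFinB.
have w_eps : \forall s \near t, w t - eps < w s.
  by apply: w_lsc => //; rewrite gtrBl.
apply: (@le_trans _ _ (ereal_inf [set V s | s in [set s | (s \in `]0, T[) /\ w t - eps < w s]])).
  apply: le_ereal_inf_tmp => _ [s /= [sT /ltW ws] <-].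
  by rewrite Vw// lee_fin.
apply: ereal_sup_ubound; eexists; last reflexivity.
by rewrite /within /=; near=> s => sT; split=> //; near: s.
Unshelve. all: by end_near. Qed.

Unset Implicit Arguments.

(** * Identification of both sides with the level *)

Theorem corollary3p4 (R : realType) (T gamma : R) (e f : R -> R)
    (u : R -> R -> R) (lo hi m : R -> R)
    (T_gt0 : 0 < T)
    (e_lip : locally_lipschitz e)
    (e_zero : forall r, e r = 0 <-> r = 0)
    (e_pinfty : e r @[r --> +oo] --> +oo)
    (e_ninfty : e r @[r --> -oo] --> -oo)
    (f_lip : [lipschitz f t | t in `]0, T[])
    (f_at0 : f t @[t --> 0^'+] --> f 0)
    (f0_le1 : `|f 0| <= 1)
    (f_incr : {in `]0, T[ &, {homo f : s t / s < t}})
    (gamma_gt0 : 0 < gamma)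
    (f_deriv : {ae lebesgue_measure, forall t : R, t \in `]0, T[ ->
       derivable f t 1 /\ gamma <= f^`()%classic t})
    (* the solutions of the viscous problems *)
    (u_sol : forall eps, 0 < eps -> visc_ivp_sol T eps e f (u eps))
    (* the barriers of the Perron construction *)
    (lo_diff : differentiable_co T lo)
    (lo_decr : {in `[0, T[ &, nonincreasing_fun lo})
    (lo_0 : lo 0 = 0)
    (m_cont : continuous m)
    (m_incr : {homo m : x y / x < y})
    (m_le : forall x, m x <= monotone_minorant e x)
    (hi_sol : visc_ivp_sol T 0 m f hi) :
  forall t : R, t \in `]0, T[ -> u_vis u t = lsc_env T (perron T e f lo hi) t.
Proof.
have e_cont := locally_lipschitz_continuous e_lip.
have f_cont : {in `]0, T[, continuous f}.
  move=> t tT; apply: lipschitz_nbhs_continuous f_lip.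
  exact: near_in_itvoo.
have f_gt t : t \in `]0, T[ -> -1 < f t.
  move=> tT; have := homo_lt_gt_right_limit f_incr f_at0 tT.
  by move: f0_le1; rewrite ler_norml => /andP[]; lra.
have e_gt0 y : 0 < y -> 0 <= e y.
  by move=> y0; apply/ltW/zero_unique_gt0.
have e_le0 y : y < 0 -> e y <= 0.
  by move=> y0; apply/ltW/zero_unique_lt0.
have m_le_e x : m x <= e x.
  exact: le_trans (m_le x) (monotone_minorant_le e_cont x e_gt0).
have m_le0 y : y < 0 -> m y <= 0.
  move=> /m_incr/ltW/le_trans; apply.
  by have := m_le_e 0; rewrite (e_zero 0).2.
have u_ge0 eps : 0 < eps -> forall t, t \in `]0, T[ -> 0 <= u eps t.
  move=> eps0; have ue := u_sol _ eps0; have [_ _ [_ _ u_super]] := ue.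
  apply: (visc_supersol_ge0 (ltW eps0) e_le0 f_gt _ u_super) => k k0.
  by apply: (cvgr_gt _ (visc_ivp_sol_cvg0 T_gt0 ue)); rewrite oppr_lt0.
have hi_ge0 t : t \in `]0, T[ -> 0 <= hi t.
  have [_ _ [_ _ hi_super]] := hi_sol.
  apply: (visc_supersol_ge0 (lexx 0) m_le0 f_gt _ hi_super) => k k0.
  by apply: (cvgr_gt _ (visc_ivp_sol_cvg0 T_gt0 hi_sol)); rewrite oppr_lt0.
have U_super := level_visc_supersol e_cont e_pinfty f_cont f_incr.
(* [e (hi t) >= m (hi t) >= f t - 1], so [hi t] is a candidate in the infimum defining the level. *)
have U_le_hi t : t \in `]0, T[ -> level e (f t - 1) <= hi t.
  move=> tT; have [_ _ [_ _ hi_super]] := hi_sol.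
  apply: level_le; first exact: hi_ge0.
  apply: le_trans (m_le_e _).
  exact: (visc_supersol0_homo_ge m_cont m_incr f_cont hi_super hi_ge0).
have lo_le0 t : t \in `]0, T[ -> lo t <= 0.
  move=> tT; rewrite -lo_0; apply: lo_decr; rewrite ?in_itv/= ?lexx//.
  - by rewrite !(itvP tT).
  - by rewrite (itvP tT).
have perronE t : t \in `]0, T[ ->
    perron T e f lo hi t = (level e (f t - 1))%:E.
  move=> tT; apply/eqP; rewrite eq_le; apply/andP; split.
    apply: ereal_inf_lbound; exists (fun s => level e (f s - 1)) => //.
    split=> // s sT; rewrite U_le_hi// andbT.
    by apply: le_trans (lo_le0 _ sT) _; exact: level_ge0.
  apply: le_ereal_inf_tmp => _ [v [v_super v_bnd] <-]; rewrite lee_fin.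
  apply: (visc_supersol0_ge_level e_cont f_cont v_super) tT.
  (* Competitors have no prescribed value at 0; the barrier [lo], which tends to 0, bounds them from
     below there. *)
  apply: (visc_supersol_ge0 (lexx 0) e_le0 f_gt _ v_super) => k k0.
  near=> s; apply: (@lt_le_trans _ _ (lo s)).
    near: s; apply: (cvgr_gt _ (differentiable_co_cvg0 lo_diff lo_0)).
    by rewrite oppr_lt0.
  have /v_bnd/andP[] // : s \in `]0, T[.
  rewrite in_itv/=; apply/andP; split; near: s.
    exact: nbhs_right_gt.
  exact: nbhs_right_lt.
(* The Perron infimum is the level, already lower semicontinuous, so the envelope leaves it
   unchanged. *)
move=> t tT; rewrite (lsc_env_id perronE U_super.1 tT).
exact: (u_vis_level e_lip e_pinfty f_cont f_incr u_sol u_ge0 tT).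
Unshelve. all: by end_near. Qed.
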